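(* Let $A$ be a nonassociative algebra over a field $F$ with subalgebras $A_1$ and $A_2$, and let $K$ be a finite field extension of $F$ such that $F$ is the fixed field of the group $\mathrm{Gal}(K/F)$ of $F$-automorphisms of $K$. For any subalgebra $B$ of $A$ write $\bar B=B\otimes_F K$. Then $A=A_1+A_2$ if and only if $\bar A=\bar A_1+\bar A_2$.
   Context: A nonassociative algebra over $F$ is an $F$-vector space with a bilinear (not necessarily associative) product. For a subalgebra $B$ of $A$, $\bar B=B\otimes_F K$ is regarded as a $K$-subalgebra of $\bar A=A\otimes_F K$. Sums are sums of subspaces. *)

(* Defs.v *)
From HB Require Import structures.
From mathcomp Require Import all_boot all_order all_algebra all_field.
From mathcomp Require Import boolp classical_sets.

Set Implicit Arguments.
Unset Strict Implicit.
Unset Printing Implicit Defensive.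

Import GRing.Theory.
Local Open Scope ring_scope.
Local Open Scope quotient_scope.

(******************************************************************************)
(*     naAlgType R == R-modules with a bilinear product x *n y, not assumed   *)
(*                    associative, commutative or unital                      *)
(*        subalg A == subspaces of A closed under *n, coercing to set A       *)
(*     addset S S' == the set of all x + y with x in S and y in S'            *)
(*      tensor U V == the tensor product of the F-modules U and V             *)
(*           u ox v == the pure tensor of u and v in tensor U V               *)
(*      tensor A K == for A : naAlgType F and K : fieldExtType F, the scalar  *)
(*                    extension of A, a naAlgType K                           *)
(*    baseChange B == the subalgebra of tensor A K obtained from B : subalg A *)
(*     fixedAuts K == the fixed field of the F-automorphisms of K             *)
(******************************************************************************)

(** * Nonassociative algebras *)

HB.mixin Record Lmodule_isNonassocAlgebra (R : nzRingType) A
    of GRing.Lmodule R A := {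
  namul : A -> A -> A;
  namul_bilinear : bilinear_for *:%R *:%R namul
}.

#[short(type="naAlgType")]
HB.structure Definition NonassocAlgebra (R : nzRingType) :=
  {A of GRing.Lmodule R A & Lmodule_isNonassocAlgebra R A}.

Notation "x *n y" := (namul x y) (at level 40, left associativity).

Section NonassocTheory.
Variables (R : nzRingType) (A : naAlgType R).
Implicit Types (x y z : A) (c : R).

Lemma namulDl x y z : (x + y) *n z = x *n z + y *n z.
Proof. by have := namul_bilinear.1 z 1 x y; rewrite /= !scale1r. Qed.

Lemma namulDr x y z : x *n (y + z) = x *n y + x *n z.
Proof. by have := namul_bilinear.2 x 1 y z; rewrite /= !scale1r. Qed.

Lemma namul0r x : 0 *n x = 0.
Proof. by apply: (addrI (0 *n x)); rewrite -namulDl !addr0. Qed.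

Lemma namulr0 x : x *n 0 = 0.
Proof. by apply: (addrI (x *n 0)); rewrite -namulDr !addr0. Qed.

Lemma nascalerAl c x y : (c *: x) *n y = c *: (x *n y).
Proof. by have := namul_bilinear.1 y c x 0; rewrite /= !addr0 namul0r addr0. Qed.

Lemma nascalerAr c x y : x *n (c *: y) = c *: (x *n y).
Proof. by have := namul_bilinear.2 x c y 0; rewrite /= !addr0 namulr0 addr0. Qed.

End NonassocTheory.

Record subalg (R : nzRingType) (A : naAlgType R) := Subalg {
  subalg_set :> set A;
  subalg0 : subalg_set 0;
  subalgD : forall x y, subalg_set x -> subalg_set y -> subalg_set (x + y);
  subalgZ : forall (c : R) x, subalg_set x -> subalg_set (c *: x);
  subalgM : forall x y, subalg_set x -> subalg_set y -> subalg_set (x *n y)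
}.

Definition addset (V : zmodType) (S S' : set V) : set V :=
  [set x + y | x in S & y in S']%classic.

(** * Tensor products over a field *)

(* [tensor U V] is the set of formal sums [:: (u1, v1); ..; (un, vn)], read as
   u1 ox v1 + ... + un ox vn, modulo the congruence generated by commutativity
   of concatenation and the bilinearity relations. The quotient of this free
   monoid is a group, the opposite of u ox v being (- u) ox v. *)
Section Tensor.
Variables (F : fieldType) (U V : lmodType F).

Inductive tensor_eq : seq (U * V) -> seq (U * V) -> Prop :=
| tensor_refl s : tensor_eq s s
| tensor_sym s t : tensor_eq s t -> tensor_eq t s
| tensor_trans s t r : tensor_eq s t -> tensor_eq t r -> tensor_eq s r
| tensor_cat s s' t t' :
    tensor_eq s s' -> tensor_eq t t' -> tensor_eq (s ++ t) (s' ++ t')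
| tensor_comm s t : tensor_eq (s ++ t) (t ++ s)
| tensor_zero v : tensor_eq [:: (0, v)] [::]
| tensor_addl u u' v : tensor_eq [:: (u + u', v)] [:: (u, v); (u', v)]
| tensor_addr u v v' : tensor_eq [:: (u, v + v')] [:: (u, v); (u, v')]
| tensor_scale (c : F) u v : tensor_eq [:: (c *: u, v)] [:: (u, c *: v)].

Definition tensor_eqb : rel (seq (U * V)) := fun s t => `[< tensor_eq s t >].

Lemma tensor_eqb_equiv : equiv_class_of tensor_eqb.
Proof.
split.
- by move=> s; apply/asboolP/tensor_refl.
- by move=> s t; apply/asboolP/asboolP; apply: tensor_sym.
- move=> t s r /asboolP st /asboolP tr; apply/asboolP.
  exact: tensor_trans st tr.
Qed.

Canonical tensor_equiv := EquivRelPack tensor_eqb_equiv.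

Definition tensor := {eq_quot tensor_equiv}.
HB.instance Definition _ := Choice.on tensor.
HB.instance Definition _ := Quotient.on tensor.
HB.instance Definition _ : EqQuotient _ tensor_equiv tensor :=
  EqQuotient.on tensor.

Lemma tensor_piP s t : reflect (tensor_eq s t) (\pi_tensor s == \pi_tensor t).
Proof. by rewrite piE; apply: asboolP. Qed.

Lemma tensor_pi s t : tensor_eq s t -> \pi_tensor s = \pi_tensor t.
Proof. by move/tensor_piP/eqP. Qed.

Lemma tensor_repr s : tensor_eq (repr (\pi_tensor s)) s.
Proof. by apply/tensor_piP; rewrite reprK. Qed.

Definition tens (u : U) (v : V) : tensor := \pi_tensor [:: (u, v)].

Definition tensor0 : tensor := \pi_tensor [::].
Definition tensorD (x y : tensor) : tensor := \pi_tensor (repr x ++ repr y).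
Definition tensorN (x : tensor) : tensor :=
  \pi_tensor [seq (- p.1, p.2) | p <- repr x].

Lemma tensorD_pi s t :
  tensorD (\pi_tensor s) (\pi_tensor t) = \pi_tensor (s ++ t).
Proof. by apply: tensor_pi; apply: tensor_cat; apply: tensor_repr. Qed.

Lemma tensorDA : associative tensorD.
Proof.
elim/quotW=> s; elim/quotW=> t; elim/quotW=> r.
by rewrite (tensorD_pi t r) (tensorD_pi s t) !tensorD_pi catA.
Qed.

Lemma tensorDC : commutative tensorD.
Proof. by move=> x y; apply: tensor_pi; apply: tensor_comm. Qed.

Lemma tensor0D : left_id tensor0 tensorD.
Proof. by move=> x; rewrite -[x]reprK tensorD_pi. Qed.

Lemma tensorND : left_inverse tensor0 tensorN tensorD.
Proof.
move=> x; rewrite -{2}[x]reprK tensorD_pi; apply: tensor_pi.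
elim: (repr x) => [|[u v] s IH] /=; first by apply: tensor_refl.
set t := map _ s in IH *.
have H1 : tensor_eq ((- u, v) :: t ++ (u, v) :: s)
                    ([:: (- u, v); (u, v)] ++ (t ++ s)).
  have -> : t ++ (u, v) :: s = (t ++ [:: (u, v)]) ++ s by rewrite -catA.
  apply: (tensor_cat (tensor_refl [:: (- u, v)])).
  exact: (tensor_cat (tensor_comm t [:: (u, v)]) (tensor_refl s)).
apply: tensor_trans H1 _; rewrite -[[::]]/([::] ++ [::]).
apply: tensor_cat IH.
apply: tensor_trans (tensor_sym (tensor_addl _ _ _)) _.
by rewrite addNr; apply: tensor_zero.
Qed.

HB.instance Definition _ :=
  GRing.isZmodule.Build tensor tensorDA tensorDC tensor0D tensorND.

Local Notation "u 'ox' v" := (tens u v) (at level 35).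

Lemma tensDl u u' v : (u + u') ox v = u ox v + u' ox v.
Proof. by rewrite /GRing.add /= tensorD_pi; apply/tensor_pi/tensor_addl. Qed.

Lemma tensDr u v v' : u ox (v + v') = u ox v + u ox v'.
Proof. by rewrite /GRing.add /= tensorD_pi; apply/tensor_pi/tensor_addr. Qed.

Lemma tensZ (c : F) u v : (c *: u) ox v = u ox (c *: v).
Proof. exact/tensor_pi/tensor_scale. Qed.

Lemma tensor_pi_nil : \pi_tensor [::] = 0.
Proof. by []. Qed.

Lemma tensor_pi_sum s : \pi_tensor s = \sum_(p <- s) p.1 ox p.2.
Proof.
elim: s => [|[u v] s IH]; first by rewrite big_nil.
by rewrite big_cons -IH [RHS]tensorD_pi.
Qed.

Lemma tensor_sum (x : tensor) :
  exists s : seq (U * V), x = \sum_(p <- s) p.1 ox p.2.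
Proof. by exists (repr x); rewrite -tensor_pi_sum reprK. Qed.

Lemma tensor_ind (P : tensor -> Prop) :
  P 0 -> (forall x y, P x -> P y -> P (x + y)) ->
  (forall u v, P (u ox v)) -> forall x, P x.
Proof.
move=> P0 PD Pt x; have [s ->] := tensor_sum x.
by elim/big_rec: _ => // p y _; apply: PD.
Qed.

Record balanced (W : zmodType) (f : U -> V -> W) : Prop := Balanced {
  balDl : forall u u' v, f (u + u') v = f u v + f u' v;
  balDr : forall u v v', f u (v + v') = f u v + f u v';
  balZ : forall (c : F) u v, f (c *: u) v = f u (c *: v)
}.

Definition tensor_lift (W : zmodType) (f : U -> V -> W) (x : tensor) : W :=
  \sum_(p <- repr x) f p.1 p.2.

(* The universal property: a balanced f factors as an additive map through
   tensor U V, uniquely by tensor_ind. *)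
Section Lift.
Variables (W : zmodType) (f : U -> V -> W).
Hypothesis fB : balanced f.

Lemma tensor_lift_pi s :
  tensor_lift f (\pi_tensor s) = \sum_(p <- s) f p.1 p.2.
Proof.
suff E r r' : tensor_eq r r' ->
    \sum_(p <- r) f p.1 p.2 = \sum_(p <- r') f p.1 p.2.
  exact/E/tensor_repr.
elim=> {s r r'} //=.
- by move=> s t r _ -> _ ->.
- by move=> ? ? ? ? _ e _ e'; rewrite !big_cat /= e e'.
- by move=> ? ?; rewrite !big_cat /= addrC.
- move=> v; rewrite big_seq1 big_nil /=.
  by apply: (addrI (f 0 v)); rewrite -(balDl fB) !addr0.
- by move=> *; rewrite big_seq1 big_cons big_seq1 /= (balDl fB).
- by move=> *; rewrite big_seq1 big_cons big_seq1 /= (balDr fB).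
- by move=> *; rewrite !big_seq1 /= (balZ fB).
Qed.

Lemma tensor_lift_tens u v : tensor_lift f (u ox v) = f u v.
Proof. by rewrite tensor_lift_pi big_seq1. Qed.

Lemma tensor_liftD x y :
  tensor_lift f (x + y) = tensor_lift f x + tensor_lift f y.
Proof.
rewrite -[x]reprK -[y]reprK [X in tensor_lift f X]tensorD_pi.
by rewrite !tensor_lift_pi big_cat.
Qed.

Lemma tensor_lift0 : tensor_lift f 0 = 0.
Proof. by rewrite -tensor_pi_nil tensor_lift_pi big_nil. Qed.

End Lift.

Lemma tensor_lift_addf (W : zmodType) (f g h : U -> V -> W) x :
  balanced f -> balanced g -> balanced h ->
  (forall u v, f u v = g u v + h u v) ->
  tensor_lift f x = tensor_lift g x + tensor_lift h x.
Proof.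
move=> fB gB hB E; elim/tensor_ind: x => [|x y IHx IHy|u v].
- by rewrite !tensor_lift0 // addr0.
- by rewrite !tensor_liftD // IHx IHy addrACA.
- by rewrite !tensor_lift_tens.
Qed.

End Tensor.

Notation "u 'ox' v" := (tens u v) (at level 35).

(** * Extension of scalars *)

Section ScalarExtension.
Variables (F : fieldType) (K : fieldExtType F).

Section Module.
Variable U : lmodType F.
Local Notation T := (tensor U K).

Definition tensor_scaler (c : K) (x : T) : T :=
  tensor_lift (fun (u : U) (k : K) => u ox (c * k)) x.

Lemma tensor_scaler_bal (c : K) :
  balanced (fun (u : U) (k : K) => u ox (c * k)).
Proof.
split=> *; first exact: tensDl.
- by rewrite mulrDr tensDr.
- by rewrite tensZ scalerAr.
Qed.

Lemma tensor_scalerE (c : K) (u : U) (k : K) :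
  tensor_scaler c (u ox k) = u ox (c * k).
Proof. exact: tensor_lift_tens (tensor_scaler_bal c) _ _. Qed.

Lemma tensor_scalerDr : right_distributive tensor_scaler +%R.
Proof. by move=> c x y; apply: tensor_liftD; apply: tensor_scaler_bal. Qed.

Lemma tensor_scaler0 (c : K) : tensor_scaler c 0 = 0.
Proof. by apply: tensor_lift0; apply: tensor_scaler_bal. Qed.

Lemma tensor_scalerA (a b : K) x :
  tensor_scaler a (tensor_scaler b x) = tensor_scaler (a * b) x.
Proof.
elim/tensor_ind: x => [|x y IHx IHy|u k]; rewrite ?tensor_scaler0 //.
- by rewrite !tensor_scalerDr IHx IHy.
- by rewrite !tensor_scalerE mulrA.
Qed.

Lemma tensor_scale1r : left_id 1 tensor_scaler.
Proof.
elim/tensor_ind=> [|x y IHx IHy|u k]; rewrite ?tensor_scaler0 //.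
- by rewrite tensor_scalerDr IHx IHy.
- by rewrite tensor_scalerE mul1r.
Qed.

Lemma tensor_scalerDl x : {morph tensor_scaler^~ x : a b / a + b}.
Proof.
move=> a b /=; apply: tensor_lift_addf; try exact: tensor_scaler_bal.
by move=> u k; rewrite mulrDl tensDr.
Qed.

HB.instance Definition _ := GRing.Zmodule_isLmodule.Build K T
  tensor_scalerA tensor_scale1r tensor_scalerDr tensor_scalerDl.

Lemma tensor_scaleE (c : K) (u : U) (k : K) :
  c *: (u ox k) = u ox (c * k) :> T.
Proof. exact: tensor_scalerE. Qed.

End Module.

Section Algebra.
Variable A : naAlgType F.
Local Notation T := (tensor A K).

Definition tensor_mul_pure (a : A) (k : K) (y : T) : T :=
  tensor_lift (fun (b : A) (l : K) => (a *n b) ox (k * l)) y.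

Lemma tensor_mul_pure_bal (a : A) (k : K) :
  balanced (fun (b : A) (l : K) => (a *n b) ox (k * l)).
Proof.
split=> *; first by rewrite namulDr tensDl.
- by rewrite mulrDr tensDr.
- by rewrite nascalerAr tensZ scalerAr.
Qed.

Definition tensor_mul (x y : T) : T :=
  tensor_lift (fun (a : A) (k : K) => tensor_mul_pure a k y) x.

Lemma tensor_mul_bal (y : T) :
  balanced (fun (a : A) (k : K) => tensor_mul_pure a k y).
Proof.
split.
- move=> a a' k; apply: tensor_lift_addf; try exact: tensor_mul_pure_bal.
  by move=> b l; rewrite namulDl tensDl.
- move=> a k k'; apply: tensor_lift_addf; try exact: tensor_mul_pure_bal.
  by move=> b l; rewrite mulrDl tensDr.
- move=> c a k; congr (tensor_lift _ _).
  by apply/funext => b; apply/funext => l; rewrite nascalerAl tensZ scalerAl.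
Qed.

Lemma tensor_mulDl x x' y :
  tensor_mul (x + x') y = tensor_mul x y + tensor_mul x' y.
Proof. by apply: tensor_liftD; apply: tensor_mul_bal. Qed.

Lemma tensor_mul0r y : tensor_mul 0 y = 0.
Proof. by apply: tensor_lift0; apply: tensor_mul_bal. Qed.

Lemma tensor_mulDr x y y' :
  tensor_mul x (y + y') = tensor_mul x y + tensor_mul x y'.
Proof.
apply: tensor_lift_addf; try exact: tensor_mul_bal.
by move=> a k; apply: tensor_liftD; apply: tensor_mul_pure_bal.
Qed.

Lemma tensor_mulE (a b : A) (k l : K) :
  tensor_mul (a ox k) (b ox l) = (a *n b) ox (k * l).
Proof.
rewrite /tensor_mul (tensor_lift_tens (tensor_mul_bal (b ox l))).
exact: (tensor_lift_tens (tensor_mul_pure_bal _ _)).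
Qed.

Lemma tensor_mulr0 x : tensor_mul x 0 = 0.
Proof. by apply: (addrI (tensor_mul x 0)); rewrite -tensor_mulDr !addr0. Qed.

Lemma tensor_mulZ (c : K) x y :
  tensor_mul (c *: x) y = c *: tensor_mul x y /\
  tensor_mul x (c *: y) = c *: tensor_mul x y.
Proof.
elim/tensor_ind: x => [|x x' [e1 e2] [e1' e2']|a k].
- by rewrite scaler0 !tensor_mul0r scaler0.
- by rewrite scalerDr !tensor_mulDl e1 e1' e2 e2' scalerDr.
elim/tensor_ind: y => [|y y' [e1 e2] [e1' e2']|b l].
- by rewrite scaler0 !tensor_mulr0 scaler0.
- by rewrite scalerDr !tensor_mulDr e1 e1' e2 e2' scalerDr.
by rewrite !tensor_scaleE !tensor_mulE tensor_scaleE -mulrA [k * (c * l)]mulrCA.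
Qed.

Lemma tensor_mul_bilinear : bilinear_for *:%R *:%R tensor_mul.
Proof.
split=> [y c x x'|x c y y'] /=.
- by rewrite tensor_mulDl (tensor_mulZ c x y).1.
- by rewrite tensor_mulDr (tensor_mulZ c x y).2.
Qed.

HB.instance Definition _ :=
  Lmodule_isNonassocAlgebra.Build K T tensor_mul_bilinear.

Lemma tens_mulE (a b : A) (k l : K) :
  (a ox k : T) *n (b ox l) = (a *n b) ox (k * l).
Proof. exact: tensor_mulE. Qed.

(* The image of the canonical map from the tensor product of B and K to
   tensor A K; the map is injective since F is a field. *)
Definition baseChange_set (B : subalg A) : set T :=
  [set x | exists2 s : seq (A * K),
     (forall p, p \in s -> (B : set A) p.1) & x = \sum_(p <- s) p.1 ox p.2]%classic.

Section BaseChange.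
Variable B : subalg A.

Lemma baseChange_set0 : baseChange_set B 0.
Proof. by exists [::]; rewrite ?big_nil. Qed.

Lemma baseChange_setD x y :
  baseChange_set B x -> baseChange_set B y -> baseChange_set B (x + y).
Proof.
move=> [s sB ->] [t tB ->]; exists (s ++ t); last by rewrite big_cat.
by move=> p; rewrite mem_cat => /orP[/sB|/tB].
Qed.

Lemma baseChange_tens (b : A) (k : K) : (B : set A) b -> baseChange_set B (b ox k).
Proof.
by exists [:: (b, k)] => [p|]; rewrite ?big_seq1 // inE => /eqP->.
Qed.

Lemma baseChange_ind (P : T -> Prop) :
  P 0 -> (forall x y, P x -> P y -> P (x + y)) ->
  (forall b k, (B : set A) b -> P (b ox k)) -> forall x, baseChange_set B x -> P x.
Proof.
move=> P0 PD Pt _ [s sB ->]; rewrite big_seq.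
by elim/big_rec: _ => // p y /sB Bp; apply: PD; apply: Pt.
Qed.

Lemma baseChange_setZ (c : K) x :
  baseChange_set B x -> baseChange_set B (c *: x).
Proof.
elim/baseChange_ind=> {x} [|x y|b k Bb].
- by rewrite scaler0; apply: baseChange_set0.
- by rewrite scalerDr; apply: baseChange_setD.
- by rewrite tensor_scaleE; apply: baseChange_tens.
Qed.

Lemma baseChange_setM x y :
  baseChange_set B x -> baseChange_set B y -> baseChange_set B (x *n y).
Proof.
move=> + By; elim/baseChange_ind=> {x} [|x x'|a k Ba].
- by rewrite namul0r; apply: baseChange_set0.
- by rewrite namulDl; apply: baseChange_setD.
elim/baseChange_ind: By => {y} [|y y'|b l Bb].
- by rewrite namulr0; apply: baseChange_set0.
- by rewrite namulDr; apply: baseChange_setD.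
- by rewrite tens_mulE; apply: baseChange_tens; apply: subalgM.
Qed.

Definition baseChange : subalg T :=
  Subalg baseChange_set0 baseChange_setD baseChange_setZ baseChange_setM.

End BaseChange.

End Algebra.

(* kAut 1 {:K} s says that s is a field automorphism of K over F; it does not
   presuppose that K is a splitting field, unlike 'Gal({:K} / 1). *)
Definition fixedAuts : set K :=
  [set x | forall s : 'End(K), kAut 1%VS {:K}%VS s -> s x = x]%classic.

End ScalarExtension.

Arguments baseChange {F} K {A} B.
Arguments fixedAuts {F} K.

(* Main.v *)
From HB Require Import structures.
Require Import Defs.
From mathcomp Require Import all_boot all_order all_algebra all_field.
From mathcomp Require Import boolp classical_sets.

Import GRing.Theory VectorInternalTheory.
Local Open Scope ring_scope.

(** Going up is additivity: a pure tensor [a ox k] with [a = a1 + a2] splits as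
    [a1 ox k + a2 ox k], and pure tensors span the scalar extension.

    Going down uses a retraction of the embedding of [A] in [tensor A K] by
    [a |-> a ox 1]. Choose an [F]-linear form [phi] on [K] with [phi 1 = 1];
    then [a ox k |-> phi k *: a] is additive, sends [a ox 1] to [a], and sends
    the scalar extension of a subalgebra [B] into [B], because [B] is closed
    under sums and scaling by [F]. Applied to a decomposition of [a ox 1] it
    yields one of [a]. *)

(** A nonzero vector has a nonzero coordinate, which can be normalised. *)
Lemma exists_linear_form_eq1 {F : fieldType} {V : vectType F} {v : V} :
  v != 0 -> exists phi : {scalar V}, phi v = 1.
Proof.
rewrite -(can_eq v2rK) linear0 => /rV0Pn[i vi0].
pose phi (u : V) : F := (v2r v 0 i)^-1 * v2r u 0 i.
have phi_lin : scalar phi.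
  by move=> c x y; rewrite /phi linearP !mxE mulrDr mulrCA.
pose phiM := GRing.isLinear.Build F V F *%R phi phi_lin.
pose phiL : {scalar V} := HB.pack phi phiM.
by exists phiL; rewrite /= /phi mulVf.
Qed.

Section Contraction.
Variables (F : fieldType) (U V : lmodType F) (phi : {scalar V}).

(** The map [id ox phi], with its target the tensor product of [U] and [F]
    identified with [U]. *)
Definition contract : tensor U V -> U :=
  tensor_lift (fun u k => phi k *: u).

Lemma contract_bal : balanced (fun (u : U) (k : V) => phi k *: u).
Proof.
split=> [u u' k|u k k'|c u k]; first exact: scalerDr.
- by rewrite linearD scalerDl.
- by rewrite scalarZ scalerA mulrC.
Qed.

Lemma contract_tens u k : contract (u ox k) = phi k *: u.
Proof. exact: tensor_lift_tens contract_bal _ _. Qed.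

Lemma contractD x y : contract (x + y) = contract x + contract y.
Proof. exact: tensor_liftD contract_bal _ _. Qed.

Lemma contract0 : contract 0 = 0.
Proof. exact: tensor_lift0 contract_bal. Qed.

End Contraction.

Arguments contract {F U V} phi x.

Lemma contract_baseChange (F : fieldType) (A : naAlgType F)
    (K : fieldExtType F) (phi : {scalar K}) (B : subalg A) (x : tensor A K) :
  baseChange_set B x -> (B : set A) (contract phi x).
Proof.
elim/baseChange_ind=> {x} [|x y|b k Bb].
- by rewrite contract0; apply: subalg0.
- by rewrite contractD; apply: subalgD.
- by rewrite contract_tens; apply: subalgZ.
Qed.

Theorem lemma2p4 (F : fieldType) (A : naAlgType F) (A1 A2 : subalg A)
    (K : fieldExtType F)
    (hK : fixedAuts K = [set x : K | x \in (1%VS : {vspace K})]%classic) :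
  ([set: A] = addset A1 A2)%classic <->
  ([set: tensor A K] = addset (baseChange K A1) (baseChange K A2))%classic.
Proof.
split=> sumA; apply/esym/seteqP; split=> // x _.
- elim/tensor_ind: x => [|_ _ [x1 Bx1 [x2 Bx2 <-]] [y1 By1 [y2 By2 <-]]|a k].
  + by exists 0; [exact: subalg0|exists 0; [exact: subalg0|rewrite addr0]].
  + exists (x1 + y1); first exact: subalgD.
    by exists (x2 + y2); [exact: subalgD|rewrite addrACA].
  + have [a1 A1a [a2 A2a <-]] : addset A1 A2 a by rewrite -sumA.
    exists (a1 ox k); first exact: baseChange_tens.
    by exists (a2 ox k); [exact: baseChange_tens|rewrite tensDl].
- have [phi phi1] := exists_linear_form_eq1 (oner_neq0 K).
  have [y By [z Bz yz]] :
      addset (baseChange K A1) (baseChange K A2) (x ox (1 : K)) by rewrite -sumA.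
  exists (contract phi y); first exact: contract_baseChange.
  exists (contract phi z); first exact: contract_baseChange.
  by rewrite -contractD yz contract_tens phi1 scale1r.
Qed.
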